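(* For each nonnegative integer $k$, the sequence $(A_{k+1}(\ell))_{\ell=1}^{2k+1}$ is symmetric; that is, $A_{k+1}(\ell)=A_{k+1}(2k+2-\ell)$ for all $\ell\in\{1,\ldots,2k+1\}$.
   Context: $S_n$ is the set of permutations of $\{1,\ldots,n\}$, written as words $\pi=\pi_1\cdots\pi_n$. The (West) stack-sorting map $s:S_n\to S_n$ is defined by the following procedure on an input $\pi=\pi_1\cdots\pi_n$, using an initially empty vertical stack. At any point in time, if there is a next entry of the input and either it is smaller than the entry at the top of the stack or the stack is empty, then that next entry is placed on top of the stack. Otherwise, the entry at the top of the stack is removed and appended to the end of the output. The procedure terminates when the output has length $n$, and $s(\pi)$ is this output. A permutation $\pi\in S_n$ is uniquely sorted if $|s^{-1}(\pi)|=1$. $A_{k+1}(\ell)$ denotes the number of uniquely sorted permutations $\pi\in S_{2k+1}$ with first entry $\pi_1=\ell$. *)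

(* Defs.v *)
(* Built on Mathematical Components. *)
From mathcomp Require Import all_boot all_fingroup.

Set Implicit Arguments.
Unset Strict Implicit.
Unset Printing Implicit Defensive.

(* ['S_n] permutes {0, ..., n-1}; the word uses the values {1, ..., n}. *)
Definition word (n : nat) (p : 'S_n) : seq nat :=
  [seq (p i).+1 | i <- enum 'I_n].

(* The input is read from its head, the top of the stack is its head, and the
   output is extended at its end. *)
Definition stack_state : Type := (seq nat * seq nat * seq nat)%type.

Definition stack_push (x : nat) (input stack output : seq nat) : stack_state :=
  (input, x :: stack, output).

Definition stack_pop (t : nat) (input stack output : seq nat) : stack_state :=
  (input, stack, rcons output t).

Definition stack_step (st : stack_state) : stack_state :=
  let: (input, stack, output) := st in
  match input, stack with
  | x :: input', [::] => stack_push x input' stack output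
  | x :: input', t :: stack' =>
      if x < t then stack_push x input' stack output
      else stack_pop t input stack' output
  | [::], t :: stack' => stack_pop t input stack' output
  | [::], [::] => st
  end.

(* Every entry is pushed once and popped once, so the procedure stops after
   exactly [2 * size w] steps; see [stack_run_done]. *)
Definition stack_run (w : seq nat) : stack_state :=
  iter (size w).*2 stack_step (w, [::], [::]).

Definition stack_sort (w : seq nat) : seq nat := (stack_run w).2.

Lemma stack_iter_spec (m : nat) (st : stack_state) :
  (size st.1.1).*2 + size st.1.2 = m ->
  exists2 out, iter m stack_step st = ([::], [::], out) &
               perm_eq out (st.1.1 ++ st.1.2 ++ st.2).
Proof.
elim: m st => [|m IHm] [[[|x inp] [|t stk]] out] //=; rewrite ?addnS ?addSn.
- by exists out.
- case=> Hm; have [|out' Ho Hp] := IHm ([::], stk, rcons out t) => //.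
  exists out'; first by rewrite -iterS iterSr.
  by apply: perm_trans Hp _; rewrite /= -cats1 catA perm_catC.
- case=> Hm; have [|out' Ho Hp] := IHm (inp, [:: x], out) => /=.
    by rewrite addn1 -Hm addn0.
  exists out'; first by rewrite -iterS iterSr.
  apply: perm_trans Hp _; rewrite /= -cat1s perm_catCA.
  by rewrite /= perm_refl.
- case=> Hm; case: (ltnP x t) => Hxt.
    have [|out' Ho Hp] := IHm (inp, [:: x, t & stk], out) => /=.
      by rewrite -Hm !addnS.
    exists out'; first by rewrite -iterS iterSr /= Hxt.
    apply: perm_trans Hp _; rewrite /= -cat1s perm_catCA.
    by rewrite /= perm_refl.
  have [|out' Ho Hp] := IHm (x :: inp, stk, rcons out t) => /=.
    by rewrite -Hm.
  exists out'; first by rewrite -iterS iterSr /= ltnNge Hxt.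
  apply: perm_trans Hp _; rewrite /= perm_cons perm_cat2l.
  by rewrite -cats1 catA perm_catC.
Qed.

Lemma stack_run_done (w : seq nat) :
  stack_run w = ([::], [::], stack_sort w).
Proof.
have [|out Ho _] := @stack_iter_spec (size w).*2 (w, [::], [::]).
  by rewrite /= addn0.
by rewrite /stack_sort /stack_run Ho.
Qed.

Lemma perm_stack_sort (w : seq nat) : perm_eq (stack_sort w) w.
Proof.
have [|out Ho] := @stack_iter_spec (size w).*2 (w, [::], [::]).
  by rewrite /= addn0.
by rewrite /= cats0 /stack_sort /stack_run Ho.
Qed.

Definition stack_preim (n : nat) (p : 'S_n) : {set 'S_n} :=
  [set q : 'S_n | stack_sort (word q) == word p].

Definition uniquely_sorted (n : nat) (p : 'S_n) : bool :=
  #|stack_preim p| == 1.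

(* [A k.+1 l] counts in ['S_(2 * k + 1)], as [k.+1.*2.-1] computes to
   [k.*2.+1]; the value of [A 0] is irrelevant. *)
Definition A (m l : nat) : nat :=
  #|[set p : 'S_(m.*2.-1) | uniquely_sorted p & head 0 (word p) == l]|.

(* Main.v *)
(* A word [L m R] with maximum [m] is sorted to [s(L) s(R) m]. Call [w] a sole
   preimage if no other word has the same image. Then [s] is a bijection from
   the sole preimages to the uniquely sorted words, and counting descents shows
   that [L m R] is a sole preimage iff [L] and [R] are both empty, or both are
   nonempty sole preimages and the first entry of [s(R)] is less than [max L].

   Let [u(S,v)] be the number of sole preimages [w] with set of entries [S] such
   that [s(w)] starts with [v], and define [nu] by [nu(0) = 1] and
   [nu(r+1) = - sum_(p+q=r-1) nu(p) nu(q)]. Removing the maximum of [V] gives, by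
   induction on [V],
     [sum_(S subset V) u(S,v) nu(|V - S|) = nu(#{x in V, x < v}) nu(#{x in V, x > v})].
   As [nu(0) = 1], this determines [u(V,v)], and it is invariant under reversing
   the order of the values. *)
Require Import Defs.
From mathcomp Require Import all_boot all_order all_fingroup all_algebra zify.

Set Implicit Arguments.
Unset Strict Implicit.
Unset Printing Implicit Defensive.

(** * Stack-sorting by decomposition at the maximum *)

Lemma seq_max_exists (x : nat) (w : seq nat) :
  exists2 m, m \in x :: w & all (geq m) (x :: w).
Proof.
elim: w x => [|y w IHw] x; first by exists x; rewrite ?mem_head //= leqnn.
have [m m_in lem] := IHw y.
case: (leqP x m) => [lexm|ltmx].
  by exists m; [rewrite inE m_in orbT | rewrite /= lexm].
exists x; rewrite ?mem_head //; apply/allP => z.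
rewrite inE => /predU1P[-> //=|/(allP lem)/= lezm].
by apply: leq_trans lezm (ltnW ltmx).
Qed.

(** Strong induction on length, cutting a word at its maximum; the scheme follows the recursion of
    [stack_sort]. *)
Lemma max_word_ind (P : seq nat -> Prop) :
  P [::] ->
  (forall (L : seq nat) (m : nat) (R : seq nat),
     uniq (L ++ m :: R) -> all (gtn m) (L ++ R) ->
     P L -> P R -> P (L ++ m :: R)) ->
  forall w : seq nat, uniq w -> P w.
Proof.
move=> P0 Pmax w; have [k] := ubnP (size w).
elim: k w => // k IHk [//|x w] /ltnSE-lek Uw.
have [m m_in lem] := seq_max_exists x w.
have [L [R def_w]] : exists L R : seq nat, x :: w = L ++ m :: R.
  by case/splitPr: m_in => L R; exists L, R.
rewrite def_w in lek Uw lem *.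
have Uw' := Uw.
rewrite cat_uniq /= in Uw; case/and4P: Uw => UL /norP[mL disLR] mR UR.
rewrite size_cat /= in lek.
apply: Pmax => //; [|apply: IHk => //; lia|apply: IHk => //; lia].
apply/allP => z; rewrite mem_cat => z_in.
rewrite /= ltn_neqAle; apply/andP; split.
  by apply/eqP => def_z; rewrite def_z (negPf mL) (negPf mR) in z_in.
apply: (allP lem); rewrite mem_cat inE.
by case/orP: z_in => ->; rewrite ?orbT.
Qed.

(** Sorting [w] is local: a stack top above all of [w] is not popped meanwhile, and a next input
    entry no smaller than [w] is not pushed before [w] has left the stack. *)
Lemma stack_iter_sort (w : seq nat) : uniq w -> forall inp stk out,
  (if stk is t :: _ then all (gtn t) w else true) ->
  (if inp is x :: _ then all (geq x) w else true) ->
  iter (size w).*2 stack_step (w ++ inp, stk, out)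
  = (inp, stk, out ++ stack_sort w).
Proof.
(* The output [o] is left unspecified but common to all contexts; the empty context then identifies
   it as [stack_sort w]. *)
move=> Uw; suff [o Ho] : exists o, forall inp stk out,
    (if stk is t :: _ then all (gtn t) w else true) ->
    (if inp is x :: _ then all (geq x) w else true) ->
    iter (size w).*2 stack_step (w ++ inp, stk, out) = (inp, stk, out ++ o).
  have E : stack_sort w = o.
    by rewrite /stack_sort /stack_run -{2}[w]cats0 Ho.
  by rewrite E.
elim/max_word_ind: w / Uw => [|L m R _ ltm [oL HL] [oR HR]].
  by exists [::] => *; rewrite cats0.
exists (oL ++ oR ++ [:: m]) => inp stk out Hstk Hinp.
move: ltm; rewrite all_cat => /andP[ltLm ltRm].
(* Read from the right: process [L], push [m], process [R], pop [m]. *)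
have -> : (size (L ++ m :: R)).*2
    = 1 + ((size R).*2 + (1 + (size L).*2)).
  by rewrite size_cat /=; lia.
rewrite !iterD -catA cat_cons HL; first last.
- by apply: sub_all ltLm => z /ltnW.
- by case: stk Hstk => // t stk; rewrite all_cat => /andP[].
have -> : iter 1 stack_step (m :: R ++ inp, stk, out ++ oL)
          = (R ++ inp, m :: stk, out ++ oL).
  case: stk Hstk => //= t stk; rewrite all_cat /= => /and3P[_ -> _] //.
rewrite HR //=; last first.
  by case: inp Hinp => // x inp; rewrite all_cat /= => /and3P[].
case: inp Hinp => [|x inp] /=; first by rewrite /stack_pop -cats1 -!catA.
rewrite all_cat /= ltnNge => /and3P[_ -> _] /=.
by rewrite /stack_pop -cats1 -!catA.
Qed.

Lemma stack_sort_max (L R : seq nat) (m : nat) :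
  uniq (L ++ m :: R) -> all (gtn m) (L ++ R) ->
  stack_sort (L ++ m :: R) = stack_sort L ++ rcons (stack_sort R) m.
Proof.
rewrite cat_uniq /= all_cat => /and4P[UL _ _ UR] /andP[ltL ltR].
rewrite {1}/stack_sort /stack_run.
have -> : (size (L ++ m :: R)).*2
    = 1 + ((size R).*2 + (1 + (size L).*2)).
  by rewrite size_cat /=; lia.
rewrite !iterD stack_iter_sort //=; last by apply: sub_all ltL => z /ltnW.
by rewrite /stack_push -[R in (R, _, _)]cats0 stack_iter_sort //= rcons_cat.
Qed.

Lemma size_stack_sort (w : seq nat) : size (stack_sort w) = size w.
Proof. exact/perm_size/perm_stack_sort. Qed.

Lemma mem_stack_sort (w : seq nat) : stack_sort w =i w.
Proof. exact/perm_mem/perm_stack_sort. Qed.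

Lemma all_stack_sort (P : pred nat) (w : seq nat) :
  all P (stack_sort w) = all P w.
Proof. exact/perm_all/perm_stack_sort. Qed.

Lemma stack_sort_eq0 (w : seq nat) : (stack_sort w == [::]) = (w == [::]).
Proof. by rewrite -!size_eq0 size_stack_sort. Qed.

Lemma head_stack_sort (w : seq nat) : w != [::] -> head 0 (stack_sort w) \in w.
Proof.
rewrite -mem_stack_sort -stack_sort_eq0.
by case: (stack_sort w) => //= *; rewrite mem_head.
Qed.

(** * Descents of sorted words *)

(** The default [x] of [head] keeps the last entry from being a descent top. *)
Fixpoint des (w : seq nat) : nat :=
  if w is x :: w' then (head x w' < x) + des w' else 0.

Lemma des_cat (a b : seq nat) (x : nat) :
  des (rcons a x ++ b) = des (rcons a x) + (head x b < x) + des b.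
Proof.
elim: a => [|y a IHa] /=; first by rewrite ltnn.
by rewrite IHa; case: a {IHa} => /= *; rewrite !addnA.
Qed.

Lemma des_rcons_max (w : seq nat) (m : nat) :
  all (gtn m) w -> des (rcons w m) = des w.
Proof.
elim/last_ind: w => [|w x _]; first by rewrite /= ltnn.
rewrite all_rcons => /andP[/= ltxm _].
by rewrite -[rcons (rcons w x) m]cats1 des_cat /= ltnn ltnNge ltnW ?addn0.
Qed.

(* In terms of hooks: each descent top of [stack_sort w] carries a hook, and the
   upper ends of the hooks are distinct and are not descent bottoms. *)
Lemma des_stack_sort (w : seq nat) :
  uniq w -> w != [::] -> (des (stack_sort w)).*2 < size w.
Proof.
move=> Uw; elim/max_word_ind: w / Uw => // L m R Um ltm IHL IHR _.
rewrite stack_sort_max // -rcons_cat des_rcons_max; last first.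
  by move: ltm; rewrite !all_cat !all_stack_sort.
rewrite size_cat /=.
case: (eqVneq L [::]) IHL => [-> _|nL /(_ isT)].
  by case: (eqVneq R [::]) IHR => [-> //|nR /(_ isT)] /=; lia.
rewrite -(size_stack_sort L); case/lastP: (stack_sort L) => [//|a x] IHL.
rewrite des_cat; case: (eqVneq R [::]) IHR => [-> _|nR /(_ isT)].
  by move: IHL; rewrite /= ltnn; lia.
by move: IHL; case: (_ < x) => /=; lia.
Qed.

(* The entry [head x b] is a further descent bottom in [b], and the hook of the
   descent top [x] has its upper end in [b]. *)
Lemma des_suffix (w : seq nat) : uniq w -> forall a x b,
  stack_sort w = rcons a x ++ b -> b != [::] -> head x b < x ->
  (des b).*2.+1 < size b.
Proof.
move=> Uw; elim/max_word_ind: w / Uw => [a x b|L m R Um ltm IHL IHR a x b].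
  by case: a.
rewrite stack_sort_max // -rcons_cat => E nb.
case/lastP: b nb E => // b m' _; rewrite -rcons_cat => /rcons_inj[E <-].
have ltab : all (gtn m) (rcons a x ++ b).
  by rewrite -E; move: ltm; rewrite !all_cat !all_stack_sort.
move: (ltab); rewrite all_cat all_rcons => /andP[/andP[/= ltxm _] ltb].
rewrite des_rcons_max // size_rcons.
case: (eqVneq b [::]) => [->|nb] /=; first by rewrite ltnNge ltnW.
have -> : head x (rcons b m) = head x b by case: b nb {E ltab ltb}.
move=> ltx.
have UR : uniq R by move: Um; rewrite cat_uniq /= => /and4P[].
(* The entry [x] lies in [s(R)] or in [s(L)]. In the first case [b] is a suffix of [s(R)]. *)
have [lt_ax|le_ax] := ltnP (size (stack_sort L)) (size (rcons a x)).
  have E2 : stack_sort R = drop (size (stack_sort L)) (rcons a x) ++ b.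
    have := congr1 (drop (size (stack_sort L))) E.
    by rewrite drop_size_cat // drop_cat lt_ax.
  have [a' E3] : exists a', drop (size (stack_sort L)) (rcons a x) = rcons a' x.
    exists (drop (size (stack_sort L)) a).
    by rewrite drop_rcons // -ltnS -(size_rcons a x).
  by rewrite E3 in E2; have := IHR _ _ _ E2 nb ltx; lia.
(* Now [b] is the rest [d] of [s(L)] followed by [s(R)]. A descent where they meet is paid for by
   the stronger bound on [d] and by the removed [m]. *)
pose d := drop (size (rcons a x)) (stack_sort L).
have EL : stack_sort L = rcons a x ++ d.
  rewrite -{1}[stack_sort L](cat_take_drop (size (rcons a x))) -/d.
  have := congr1 (take (size (rcons a x))) E.
  by rewrite takel_cat // (take_size_cat _ (erefl _)) => ->.
have Eb : b = d ++ stack_sort R.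
  have := congr1 (drop (size (rcons a x))) E.
  by rewrite EL -catA !(drop_size_cat _ (erefl _)).
have dR : R != [::] -> (des (stack_sort R)).*2 < size (stack_sort R).
  by move=> nR; rewrite size_stack_sort des_stack_sort.
case: (eqVneq d [::]) => [d0|nd].
  rewrite d0 /= in Eb; rewrite Eb ltnS; apply: dR.
  by rewrite -stack_sort_eq0 -Eb.
have hd : head x d = head x b by rewrite Eb; case: (d) nd.
have IH := IHL _ _ _ EL nd; rewrite hd in IH; have {}IH := IH ltx.
rewrite Eb size_cat; case/lastP: d nd IH {hd EL Eb} => // d y _ IH.
rewrite des_cat; case: (eqVneq R [::]) dR => [-> _|_ /(_ isT)].
  by move: IH; rewrite /= ltnn; lia.
by move: IH; case: (_ < y) => /=; lia.
Qed.

(** [L] is absorbed into whichever part of [R] has its image first, until it stands before a single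
    letter. For any larger [m], the words [L m R] and [T m] then have the same image. *)
Lemma stack_sort_merge (R : seq nat) : uniq R -> forall L,
  uniq (L ++ R) -> R != [::] -> all (gtn (head 0 (stack_sort R))) L ->
  exists2 T, perm_eq T (L ++ R) & stack_sort T = stack_sort L ++ stack_sort R.
Proof.
move=> UR; elim/max_word_ind: R / UR => // R1 m R2 Um ltm IH1 IH2 L ULR _ ltL.
have leqm : head 0 (stack_sort (R1 ++ m :: R2)) <= m.
  have : all (geq m) (stack_sort (R1 ++ m :: R2)).
    rewrite all_stack_sort; move: ltm; rewrite !all_cat /= leqnn.
    by case/andP => h1 h2; apply/andP; split;
      apply: sub_all (_ : all (gtn m) _) => // z /ltnW.
  by case: (stack_sort _) => //= z s /andP[].
have ltLm : all (gtn m) L by apply: sub_all ltL => z /= h; apply: leq_trans leqm.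
have build T1 T2 : perm_eq (T1 ++ T2) (L ++ R1 ++ R2) ->
    stack_sort T1 ++ stack_sort T2
      = stack_sort L ++ stack_sort R1 ++ stack_sort R2 ->
    exists2 T, perm_eq T (L ++ R1 ++ m :: R2) &
      stack_sort T = stack_sort L ++ stack_sort (R1 ++ m :: R2).
  move=> pT sT; have pT' : perm_eq (T1 ++ m :: T2) (L ++ R1 ++ m :: R2).
    apply/seq.permP => p; have /seq.permP/(_ p) := pT.
    by rewrite !count_cat /=; lia.
  exists (T1 ++ m :: T2) => //.
  rewrite !stack_sort_max ?(perm_uniq pT') //.
    by rewrite -!rcons_cat sT.
  by rewrite (perm_all _ pT) all_cat ltLm ltm.
have U12 : uniq (L ++ R1 ++ R2).
  apply: subseq_uniq ULR; rewrite !cat_subseq // subseq_cons //.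
rewrite stack_sort_max // in ltL.
case: (eqVneq R1 [::]) => [R1_0|nR1].
  case: (eqVneq R2 [::]) => [R2_0|nR2].
    by apply: (build L [::]); rewrite R1_0 R2_0.
  have [||//|T pT sT] := IH2 L.
  - by move: U12; rewrite R1_0.
  - by [].
  - move: ltL; rewrite R1_0 /=; move: nR2; rewrite -stack_sort_eq0.
    by case: (stack_sort R2).
  apply: (build T [::]); first by rewrite R1_0 cats0.
  by rewrite sT R1_0 cats0.
have [||//|T pT sT] := IH1 L.
- by apply: subseq_uniq U12; rewrite cat_subseq // prefix_subseq.
- by [].
- move: ltL; move: nR1; rewrite -stack_sort_eq0.
  by case: (stack_sort R1).
apply: (build T R2); first by rewrite catA perm_cat2r.
by rewrite sT catA.
Qed.

(** * Words that are the only preimage of their image *)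

(** Comparing with rearrangements alone makes this decidable and loses nothing, since [stack_sort]
    permutes its input. *)
Definition sole_preimage (w : seq nat) : bool :=
  all (fun w' => (stack_sort w' == stack_sort w) ==> (w' == w)) (permutations w).

Lemma stack_sort_perm_inj (v w : seq nat) :
  stack_sort v = stack_sort w -> perm_eq v w.
Proof.
move=> E; apply: perm_trans (perm_stack_sort w).
by rewrite -E perm_sym perm_stack_sort.
Qed.

Lemma sole_preimageP (w : seq nat) :
  reflect (forall w', stack_sort w' = stack_sort w -> w' = w) (sole_preimage w).
Proof.
apply: (iffP allP) => [sole_w w' E|sole_w w' _].
  have pw : w' \in permutations w.
    by rewrite mem_permutations stack_sort_perm_inj.
  by move: (sole_w _ pw); rewrite E eqxx => /eqP.
by apply/implyP => /eqP/sole_w ->.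
Qed.

Lemma cat_cons_inj (T : eqType) (m : T) (L R L' R' : seq T) :
  m \notin L -> m \notin L' -> L' ++ m :: R' = L ++ m :: R -> L' = L /\ R' = R.
Proof.
move=> mL mL' E; have := congr1 (index m) E.
rewrite !index_cat (negPf mL) (negPf mL') /= eqxx !addn0 => sz.
by move/eqP: E; rewrite eqseq_cat // => /andP[/eqP-> /eqP[->]].
Qed.

Section SoleMax.

Variables (L R : seq nat) (m : nat).
Hypotheses (Um : uniq (L ++ m :: R)) (ltm : all (gtn m) (L ++ R)).

Let UL : uniq L.
Proof. by move: Um; rewrite cat_uniq => /and3P[]. Qed.

Let UR : uniq R.
Proof. by move: Um; rewrite cat_uniq /= => /and4P[]. Qed.

Let ULR : uniq (L ++ R).
Proof. by apply: subseq_uniq Um; rewrite cat_subseq // subseq_cons. Qed.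

Let mLR : m \notin L ++ R.
Proof. by apply/negP => /(allP ltm); rewrite /= ltnn. Qed.

(** Another such pair would give a second preimage [L' m R']. *)
Lemma sole_preimage_resplit (L' R' : seq nat) : sole_preimage (L ++ m :: R) ->
  stack_sort L' ++ stack_sort R' = stack_sort L ++ stack_sort R ->
  L' = L /\ R' = R.
Proof.
move=> /sole_preimageP sole_w E; have pE : perm_eq (L' ++ R') (L ++ R).
  have perm2 v w : perm_eq (stack_sort v ++ stack_sort w) (v ++ w).
    by rewrite perm_cat ?perm_stack_sort.
  by apply: perm_trans (perm2 L R); rewrite -E perm_sym.
have pE' : perm_eq (L' ++ m :: R') (L ++ m :: R).
  by apply/seq.permP => p; have /seq.permP/(_ p) := pE; rewrite !count_cat /=; lia.
have mLR' : m \notin L' ++ R' by rewrite (perm_mem pE).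
move: (mLR) mLR'; rewrite !mem_cat => /norP[mL _] /norP[mL' _].
apply: (cat_cons_inj mL mL'); apply: sole_w.
by rewrite !stack_sort_max ?(perm_all _ pE) ?(perm_uniq pE') // -!rcons_cat E.
Qed.

(** A failing condition yields a second preimage: replace [L] or [R] by a rival, move a lone
    nonempty side across [m], or absorb [L] into [R] by [stack_sort_merge]. *)
Lemma sole_preimage_split : sole_preimage (L ++ m :: R) ->
  (L == [::]) && (R == [::]) ||
  [&& L != [::], R != [::], sole_preimage L, sole_preimage R
    & has (ltn (head 0 (stack_sort R))) L].
Proof.
move=> sole_w; have resplit := sole_preimage_resplit sole_w.
have -> : sole_preimage L.
  by apply/sole_preimageP => L' E; case: (resplit L' R); rewrite ?E.
have -> : sole_preimage R.
  by apply/sole_preimageP => R' E; case: (resplit L R'); rewrite ?E.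
case: (eqVneq L [::]) => [L0|nL] /=.
  by case: (resplit R [::]) => [|_ <-]; rewrite ?L0 ?cats0.
case: (eqVneq R [::]) => [R0|nR] /=.
  by case: (resplit [::] L); rewrite ?R0 ?cats0 // => L0; rewrite -L0 in nL.
apply/negPn/negP => /hasPn leL.
have [|T pT sT] := stack_sort_merge UR ULR nR.
  apply/allP => x xL; rewrite /= ltn_neqAle leqNgt leL // andbT.
  apply/eqP => def_x; have xR : x \in R.
    by rewrite def_x head_stack_sort.
  by move: ULR; rewrite cat_uniq => /and3P[_ /hasP[]]; exists x.
by case: (resplit T [::]) => [|_ R0]; [rewrite cats0 | rewrite -R0 in nR].
Qed.

End SoleMax.

Lemma leq_last_stack_sort (w : seq nat) (x : nat) :
  uniq w -> x \in w -> x <= last 0 (stack_sort w).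
Proof.
move=> Uw; elim/max_word_ind: w / Uw => // L m R Um ltm _ _.
rewrite stack_sort_max // -rcons_cat last_rcons mem_cat inE orbCA => /predU1P[-> //|].
by rewrite -mem_cat => /(allP ltm)/ltnW.
Qed.

Lemma des_junction (a b : seq nat) : a != [::] -> b != [::] ->
  des (a ++ b) = des a + (head 0 b < last 0 a) + des b.
Proof.
by case/lastP: a => // a x _; case: b => // y b _; rewrite des_cat last_rcons.
Qed.

(** Sole preimages attain the bound of [des_stack_sort]: [s(L)] ends with the maximum of [L], so its
    junction with [s(R)] is a descent. *)
Lemma des_sole_preimage (w : seq nat) :
  uniq w -> w != [::] -> sole_preimage w -> size w = (des (stack_sort w)).*2.+1.
Proof.
move=> Uw; elim/max_word_ind: w / Uw => // L m R Um ltm IHL IHR _ sole_w.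
have ltsm : all (gtn m) (stack_sort L ++ stack_sort R).
  by move: ltm; rewrite !all_cat !all_stack_sort.
rewrite stack_sort_max // -rcons_cat des_rcons_max // size_cat /=.
have := sole_preimage_split Um ltm sole_w.
case/orP => [/andP[/eqP-> /eqP->] //|].
case/and5P=> nL nR sL sR /hasP[x xL /= ltx].
rewrite IHL // IHR //.
rewrite des_junction ?stack_sort_eq0 // (leq_trans ltx) ?leq_last_stack_sort //.
  by lia.
by move: Um; rewrite cat_uniq => /and3P[].
Qed.

(** Otherwise [s(R)] contains the last entry of [s(L')] followed by [s(R')], and [des_suffix]
    contradicts the tight length of [R']. *)
Lemma no_earlier_split (L R L' R' : seq nat) : uniq R ->
  stack_sort L ++ stack_sort R = stack_sort L' ++ stack_sort R' ->
  R' != [::] -> head 0 (stack_sort R') < last 0 (stack_sort L') ->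
  size R' = (des (stack_sort R')).*2.+1 -> size L' <= size L.
Proof.
move=> UR E nR' junction tight; rewrite leqNgt; apply/negP => ltL.
have {E} := congr1 (drop (size (stack_sort L))) E.
rewrite drop_size_cat // drop_cat !size_stack_sort ltL.
rewrite -(size_stack_sort L') in ltL.
case/lastP: (stack_sort L') ltL junction => // a x ltL.
rewrite size_rcons ltnS in ltL; rewrite last_rcons drop_rcons // => junction.
move=> /(des_suffix UR) suffix.
have nb : stack_sort R' != [::] by rewrite stack_sort_eq0.
have := suffix nb; rewrite -tight size_stack_sort ltnn => absurd.
by apply: notF; apply: absurd; case: (stack_sort R') nb junction.
Qed.

(** For the converse, the image of a rival [L' m R'] has the same descents, which leaves no slack in
    its bounds; [no_earlier_split] in both directions then makes the cuts coincide. *)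
Lemma sole_preimage_max (L R : seq nat) (m : nat) :
  uniq (L ++ m :: R) -> all (gtn m) (L ++ R) ->
  sole_preimage (L ++ m :: R) = (L == [::]) && (R == [::]) ||
    [&& L != [::], R != [::], sole_preimage L, sole_preimage R
      & has (ltn (head 0 (stack_sort R))) L].
Proof.
move=> Um ltm; apply/idP/idP; first exact: sole_preimage_split.
case/orP => [/andP[/eqP-> /eqP->]|].
  by apply/sole_preimageP => w' /stack_sort_perm_inj/perm_small_eq ->.
case/and5P=> nL nR soleL soleR /hasP[x xL /= ltx].
have UL : uniq L by move: Um; rewrite cat_uniq => /and3P[].
have UR : uniq R by move: Um; rewrite cat_uniq /= => /and4P[].
have tL := des_sole_preimage UL nL soleL.
have tR := des_sole_preimage UR nR soleR.
have junction : head 0 (stack_sort R) < last 0 (stack_sort L).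
  by apply: leq_trans ltx (leq_last_stack_sort UL xL).
apply/sole_preimageP => w' E; have pE := stack_sort_perm_inj E.
have Uw' : uniq w' by rewrite (perm_uniq pE).
elim/max_word_ind: w' / Uw' E pE => [|L' m' R' Um' ltm' _ _].
  by move=> _ /perm_size; rewrite size_cat /= addnS.
rewrite !stack_sort_max // -!rcons_cat => /rcons_inj[E ->] pE.
have sz : size L' + size R' = size L + size R.
  by have := perm_size pE; rewrite !size_cat /=; lia.
have UL' : uniq L' by move: Um'; rewrite cat_uniq => /and3P[].
have UR' : uniq R' by move: Um'; rewrite cat_uniq /= => /and4P[].
(* [L] and [R] each exceed twice their descents by one, and the junction descent absorbs both
   units. *)
have D : (des (stack_sort L' ++ stack_sort R')).*2 = size L + size R.
  rewrite E des_junction ?stack_sort_eq0 // junction {1}tL tR /=.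
  by rewrite !doubleD !addnS !addSn addn0.
(* If [L'] or [R'] were empty, the other would have length twice its descents, against
   [des_stack_sort]. *)
have nL' : L' != [::].
  apply/eqP => L'0; rewrite L'0 /= in D sz.
  have nR' : R' != [::] by rewrite -size_eq0 [size R']sz tL.
  by have := des_stack_sort UR' nR'; rewrite D -sz ltnn.
have nR' : R' != [::].
  apply/eqP => R'0; rewrite R'0 cats0 addn0 /= in D sz.
  have := des_stack_sort UL'; rewrite D -sz ltnn -size_eq0 sz tL.
  by move/(_ isT).
move: D; rewrite des_junction ?stack_sort_eq0 // => D.
have bL := des_stack_sort UL' nL'; have bR := des_stack_sort UR' nR'.
(* Each side is longer than twice its descents; by [D] this requires a descent at the junction and
   equality in both bounds. *)
have [junction' tR'] : head 0 (stack_sort R') < last 0 (stack_sort L') /\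
    size R' = (des (stack_sort R')).*2.+1.
  by move: D sz bL bR {tL tR}; case: (_ < _); clear => /=; lia.
have szL : size (stack_sort L') = size (stack_sort L).
  apply/eqP; rewrite !size_stack_sort eqn_leq.
  by rewrite (no_earlier_split UR (esym E)) ?(no_earlier_split UR' E).
move/eqP: E; rewrite eqseq_cat // => /andP[/eqP EL /eqP ER].
by rewrite (sole_preimageP _ soleL _ EL) (sole_preimageP _ soleR _ ER).
Qed.

(** * The counting identity and its symmetry *)

Section SubsetTransform.

Import GRing.Theory.
Local Open Scope ring_scope.

(** These are the aerated signed Catalan numbers: [nu(2j) = (-1)^j Cat(j)], and [nu] vanishes at odd
    arguments. *)
Lemma signed_catalan_exists : exists nu : nat -> int, nu 0%N = 1 /\
  forall r, nu r.+1 = - \sum_(p < r) nu p * nu (r.-1 - p)%N.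
Proof.
(* The recursion uses all earlier values: [pre k] lists the first [k] of them, and [next] computes
   the following one. *)
pose next (s : seq int) : int :=
  if size s is r.+1 then - \sum_(p < r) s`_p * s`_(r.-1 - p) else 1.
pose pre := fix pre k := if k is k'.+1 then rcons (pre k') (next (pre k')) else [::].
have size_pre k : size (pre k) = k by elim: k => //= k IHk; rewrite size_rcons IHk.
have nth_pre k i : (i < k)%N -> (pre k)`_i = next (pre i).
  elim: k => //= k IHk; rewrite ltnS nth_rcons size_pre.
  by case: ltngtP => // [/IHk //|-> _].
exists (fun k => next (pre k)); split=> // r.
rewrite {1}/next size_pre; congr (- _); apply: eq_bigr => p _.
by rewrite !nth_pre //; have := ltn_ord p; lia.
Qed.

Variable n : nat.
Implicit Types (S T V W : {set 'I_n}) (v w m : 'I_n).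

Definition below V v := [set x in V | (x < v)%N].
Definition above V v := [set x in V | (v < x)%N].

Lemma set_max_exists V : V != set0 ->
  exists2 m, m \in V & forall x, x \in V -> (x <= m)%N.
Proof.
case/set0Pn=> x0 Vx0; case: (arg_maxnP (fun x : 'I_n => x : nat) Vx0) => m Vm max_m.
by exists m.
Qed.

(** The element of rank [p] has [p] elements below it. The induction removes the maximum, which lies
    above every other element and so shifts the second argument of [g]. *)
Lemma sum_ranks V (g : nat -> nat -> int) :
  \sum_(w in V) g #|below V w| #|above V w|
  = \sum_(p < #|V|) g p (#|V|.-1 - p)%N.
Proof.
have [r] := ubnP #|V|; elim: r V g => // r IHr V g /ltnSE-leVr.
case: (eqVneq V set0) => [->|nV]; first by rewrite cards0 big_ord0 big_set0.
have [m Vm max_m] := set_max_exists nV.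
have cV := cardsD1 m V; rewrite Vm add1n in cV.
have ltm x : x \in V :\ m -> (x < m)%N.
  by rewrite !inE ltn_neqAle => /andP[ne /max_m ->]; rewrite andbT.
rewrite (big_setD1 m) //= addrC cV big_ord_recr /= subnn; congr (_ + g _ _).
- under eq_bigr => w Ww.
    have -> : below V w = below (V :\ m) w.
      apply/setP => x; rewrite !inE; case: eqVneq => [->|//].
      by rewrite ltnNge (ltnW (ltm w Ww)) andbF.
    have -> : #|above V w| = #|above (V :\ m) w|.+1.
      rewrite (cardsD1 m) !inE Vm ltm //= add1n; congr _.+1.
      by apply: eq_card => x; rewrite !inE andbA.
    over.
  rewrite (IHr _ (fun b a => g b a.+1)) ?cV //; last by rewrite cV in leVr.
  case: #|V :\ m| => [|k]; first by rewrite !big_ord0.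
  by apply: eq_bigr => p _; rewrite subSn // -ltnS.
- apply: eq_card => x; rewrite !inE ltn_neqAle (inj_eq val_inj).
  by case Vx: (x \in V); rewrite ?andbF //= max_m ?andbT.
- apply/eqP; rewrite cards_eq0; apply/eqP/setP => x; rewrite !inE ltnNge.
  by case Vx: (x \in V) => //=; rewrite max_m.
Qed.

Lemma sum_supersets S V (F : {set 'I_n} -> int) : S \subset V ->
  \sum_(T : {set 'I_n} | (T \subset V) && (S \subset T)) F T
  = \sum_(T : {set 'I_n} | T \subset V :\: S) F (S :|: T).
Proof.
move=> sSV; rewrite (reindex_onto (fun T => S :|: T) (fun T => T :\: S)) /=.
  apply: eq_bigl => T; rewrite subUset sSV subsetUl andbT /= subsetD.
  apply: andb_id2l => _; rewrite setDUl setDv set0U.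
  exact: sameP eqP setDidPl.
by move=> T /andP[_ /setUidPr sST]; rewrite setDE setUIr setUCr setIT.
Qed.

(** [u] abstracts the count of sole preimages. In [u_rec], [S1] is the set of entries of [L] and [w]
    the first entry of [s(R)]; an empty side contributes nothing. *)
Variables (u : {set 'I_n} -> 'I_n -> int) (nu : nat -> int).
Hypothesis nu0 : nu 0%N = 1.
Hypothesis nuS : forall r, nu r.+1 = - \sum_(p < r) nu p * nu (r.-1 - p)%N.
Hypothesis u_notin : forall S v, v \notin S -> u S v = 0.
Hypothesis u_max : forall S m, m \in S -> (forall x, x \in S -> (x <= m)%N) ->
  u S m = (S == [set m])%:R.
Hypothesis u_rec : forall S m v, m \in S ->
  (forall x, x \in S -> (x <= m)%N) -> v != m ->
  u S v = \sum_(S1 : {set 'I_n} | S1 \subset S :\ m)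
    \sum_(w : 'I_n | [exists x in S1, (w < x)%N]) u S1 v * u (S :\ m :\: S1) w.

Lemma sum_nu_ranks V :
  \sum_(w in V) nu #|below V w| * nu #|above V w| = - nu #|V|.+1.
Proof. by rewrite (sum_ranks V (fun b a => nu b * nu a)) nuS opprK. Qed.

(* In exponential generating functions in the numbers [x], [y] of values below
   and above the first entry: [F(x,y) nu(x+y) = nu(x) nu(y)]. *)
Lemma subset_transform V v : v \in V ->
  \sum_(S : {set 'I_n} | S \subset V) u S v * nu #|V :\: S|
  = nu #|below V v| * nu #|above V v|.
Proof.
have [r] := ubnP #|V|; elim: r V v => // r IHr V v /ltnSE-leVr Vv.
have [m Vm max_m] : exists2 m, m \in V & forall x, x \in V -> (x <= m)%N.
  by apply: set_max_exists; apply/set0Pn; exists v.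
have cV := cardsD1 m V; rewrite Vm add1n in cV.
have ltm x : x \in V :\ m -> (x < m)%N.
  by rewrite !inE ltn_neqAle => /andP[ne /max_m ->]; rewrite andbT.
case: (eqVneq v m) => [->{v Vv}|nvm].
  rewrite (bigD1 [set m]) ?sub1set //= big1 ?addr0 => [|S /andP[sSV nS]].
    rewrite u_max ?set11 // => [|x /set1P-> //].
    rewrite eqxx mul1r (_ : above V m = set0) ?cards0 ?nu0 ?mulr1.
      congr (nu #|pred_of_set _|); apply/setP => x; rewrite !inE ltn_neqAle.
      rewrite (inj_eq val_inj).
      by case Vx: (x \in V); rewrite ?andbF //= max_m ?andbT.
    apply/setP => x; rewrite !inE ltnNge.
    by case Vx: (x \in V); rewrite //= max_m.
  case Sm: (m \in S); last by rewrite u_notin ?Sm // mul0r.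
  rewrite u_max // ?(negPf nS) ?mul0r // => x /(subsetP sSV).
  exact: max_m.
pose V' := V :\ m; have Vv' : v \in V' by rewrite !inE nvm.
(* Sets containing [m] are expanded by [u_rec], the others by [sum_nu_ranks]. The resulting sums
   have opposite signs and differ only in the range of [w]. *)
rewrite (bigID (fun S : {set 'I_n} => [set m] \subset S)) /=.
rewrite sum_supersets ?sub1set // -/V'.
have -> : \sum_(S : {set 'I_n} | S \subset V')
      u ([set m] :|: S) v * nu #|V :\: ([set m] :|: S)|
    = \sum_(S1 : {set 'I_n} | S1 \subset V')
        \sum_(w in V' :\: S1 | [exists x in S1, (w < x)%N])
        u S1 v * (nu #|below (V' :\: S1) w| * nu #|above (V' :\: S1) w|).
  transitivity (\sum_(S : {set 'I_n} | S \subset V')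
      \sum_(S1 : {set 'I_n} | S1 \subset S)
        \sum_(w : 'I_n | [exists x in S1, (w < x)%N])
        u S1 v * u (S :\: S1) w * nu #|V' :\: S|).
    apply: eq_bigr => S sSV'; have mS : m \notin S.
      by apply/negP => /(subsetP sSV'); rewrite !inE eqxx.
    rewrite (@u_rec _ m) ?setU11 //; last first.
      by move=> x /setU1P[-> //|/(subsetP sSV')/setD1P[_ /max_m]].
    rewrite setU1K // -setDDl mulr_suml; apply: eq_bigr => S1 _.
    by rewrite mulr_suml.
  rewrite (exchange_big_dep (fun S1 : {set 'I_n} => S1 \subset V')) /=; last first.
    by move=> S S1 sSV' sS1S; apply: subset_trans sSV'.
  apply: eq_bigr => S1 sS1V'; rewrite sum_supersets // exchange_big /=.
  rewrite [RHS]big_mkcondl; apply: eq_bigr => w _.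
  have E (T : {set 'I_n}) : T \subset V' :\: S1 ->
      u S1 v * u ((S1 :|: T) :\: S1) w * nu #|V' :\: (S1 :|: T)|
      = u S1 v * (u T w * nu #|(V' :\: S1) :\: T|).
    rewrite subsetD => /andP[_ /setDidPl dTS1].
    by rewrite setDUl setDv set0U dTS1 -setDDl mulrA.
  (* The sum over [T] is the identity for [V' :\: S1] and [w]; it vanishes for [w] outside this
     set. *)
  rewrite (eq_bigr _ E) -mulr_sumr; case: ifP => Ww; last first.
    rewrite big1 ?mulr0 // => T sTW; rewrite u_notin ?mul0r //.
    by apply/negP => /(subsetP sTW); rewrite Ww.
  rewrite IHr //; apply: leq_ltn_trans (subset_leq_card (subsetDl _ _)) _.
  by rewrite -cV.
have -> : \sum_(S : {set 'I_n} | (S \subset V) && ~~ ([set m] \subset S))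
      u S v * nu #|V :\: S|
    = - \sum_(S1 : {set 'I_n} | S1 \subset V')
        \sum_(w in V' :\: S1)
        u S1 v * (nu #|below (V' :\: S1) w| * nu #|above (V' :\: S1) w|).
  rewrite -sumrN; apply: eq_big => [S|S /andP[sSV mS]].
    by rewrite subsetD1 sub1set.
  rewrite -mulr_sumr sum_nu_ranks -mulrN opprK; congr (_ * nu _).
  rewrite sub1set in mS; rewrite (cardsD1 m) !inE Vm mS add1n; congr _.+1.
  by apply: eq_card => x; rewrite !inE andbCA.
(* What survives are the pairs in which [w] is above all of [S1]; exchanging the
   sums, the induction hypothesis applies to [below V' w]. *)
rewrite -sumrB.
under eq_bigr => S1 _.
  rewrite [X in _ - X](bigID (fun w : 'I_n => [exists x in S1, (w < x)%N])) /=.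
  rewrite opprD addrA subrr sub0r; over.
rewrite sumrN.
(* [above V v] is [above V' v] together with [m], so [sum_nu_ranks] also turns the right-hand side
   into a sum over [w]. *)
transitivity (- \sum_(w in above V' v) nu #|below V v| *
    (nu #|below (above V' v) w| * nu #|above (above V' v) w|)); last first.
  rewrite -mulr_sumr sum_nu_ranks mulrN opprK; congr (_ * nu _).
  rewrite (cardsD1 m (above V v)) !inE Vm ltm //= add1n; congr _.+1.
  by apply: eq_card => x; rewrite !inE andbA.
congr (- _); rewrite (exchange_big_dep (mem V')) /=; last first.
  by move=> S1 w _ /andP[/setDP[]].
rewrite [RHS](eq_bigl (fun w => (w \in V') && (v < w)%N)); last first.
  by move=> w; rewrite inE.
rewrite [RHS]big_mkcondr; apply: eq_bigr => w V'w.
(* For fixed [w] the remaining [S1] are the subsets of [below V' w]; they contribute nothing unless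
   [v < w]. *)
transitivity (\sum_(S1 : {set 'I_n} | S1 \subset below V' w)
    u S1 v * nu #|below V' w :\: S1| * nu #|above V' w|).
  have lt_sub (S1 : {set 'I_n}) x : ~~ [exists x in S1, (w < x)%N] ->
      x \in S1 -> (w < x)%N = false.
    by rewrite negb_exists_in => /forall_inP/(_ x) lew /lew/negPf.
  apply: eq_big => [S1|S1 /and3P[sS1 /setDP[_ wS1] noex]].
    apply/and3P/subsetP => [[sS1 /setDP[_ wS1] noex] x xS1|sS1].
      rewrite inE (subsetP sS1) //= ltn_neqAle leqNgt (lt_sub S1) // andbT.
      by rewrite (inj_eq val_inj); apply: contraNneq wS1 => <-.
    split; first by apply/subsetP => x /sS1; rewrite inE => /andP[].
      by rewrite inE V'w andbT; apply/negP => /sS1; rewrite inE ltnn andbF.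
    rewrite negb_exists_in; apply/forall_inP => x /sS1.
    by rewrite inE -leqNgt => /andP[_ /ltnW].
  rewrite mulrA; congr (_ * nu _ * nu _); apply: eq_card => x.
    by rewrite !inE -!andbA.
  by rewrite !inE; case xS1: (x \in S1); rewrite // (lt_sub S1) ?andbF.
rewrite -mulr_suml; case: ltnP => [ltvw|lewv]; last first.
  rewrite big1 ?mul0r // => S1 sS1; rewrite u_notin ?mul0r //.
  by apply/negP => /(subsetP sS1); rewrite !inE ltnNge lewv andbF.
have vw : v \in below V' w by rewrite inE Vv'.
have ltw : (#|below V' w| < r)%N.
  apply: leq_ltn_trans (subset_leq_card _) (_ : #|V'| < r)%N; last by rewrite -cV.
  by apply/subsetP => x; rewrite inE => /andP[].
rewrite (IHr _ _ ltw vw).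
rewrite -mulrA; congr (nu _ * (nu _ * nu _)); apply: eq_card => x; rewrite !inE.
- case: (ltnP x v) => [ltxv|_]; last by rewrite !andbF.
  rewrite (ltn_trans ltxv ltvw) !andbT; case: eqVneq => // def_x.
  by rewrite def_x ltnNge ltnW ?ltm in ltxv.
- by rewrite andbAC.
- by case: (ltnP w x) => [/(ltn_trans ltvw) ->|_]; rewrite ?andbT ?andbF.
Qed.

(** Reversal swaps the two factors on the right of [subset_transform]. By induction the terms of
    proper subsets agree, and the remaining term has coefficient [nu 0 = 1]. *)
Lemma u_rev S v : u [set rev_ord x | x in S] (rev_ord v) = u S v.
Proof.
have [r] := ubnP #|S|; elim: r S => // r IHr S /ltnSE-leSr.
pose rev (S : {set 'I_n}) : {set 'I_n} := [set rev_ord x | x in S].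
have mem_rev T x : (rev_ord x \in rev T) = (x \in T).
  by rewrite mem_imset //; apply: rev_ord_inj.
rewrite -/(rev S); case Sv: (v \in S); last by rewrite !u_notin ?mem_rev ?Sv.
have card_rev T : #|rev T| = #|T| by rewrite card_imset //; apply: rev_ord_inj.
have below_rev : #|below (rev S) (rev_ord v)| = #|above S v|.
  rewrite -[RHS]card_rev; apply: eq_card => x.
  rewrite -[x]rev_ordK; move: (rev_ord x) => y.
  rewrite mem_rev !inE mem_rev /=; congr (_ && _).
  by have := ltn_ord y; have := ltn_ord v; lia.
have above_rev : #|above (rev S) (rev_ord v)| = #|below S v|.
  rewrite -[RHS]card_rev; apply: eq_card => x.
  rewrite -[x]rev_ordK; move: (rev_ord x) => y.
  rewrite mem_rev !inE mem_rev /=; congr (_ && _).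
  by have := ltn_ord y; have := ltn_ord v; lia.
have rvS : rev_ord v \in rev S by rewrite mem_rev.
have := subset_transform rvS; rewrite below_rev above_rev mulrC.
rewrite -(subset_transform Sv) (reindex_inj (imset_inj (@rev_ord_inj n))) /=.
rewrite (bigD1 S) //= [X in _ = X -> _](bigD1 S) //= !setDv cards0 nu0 !mulr1.
have revS T : (rev T \subset rev S) = (T \subset S).
  apply/subsetP/subsetP => sTS x.
    by rewrite -(mem_rev T) -(mem_rev S); apply: sTS.
  by rewrite -[x]rev_ordK !mem_rev; apply: sTS.
under eq_bigl => T do rewrite revS.
rewrite (eq_bigr (fun T : {set 'I_n} => u T v * nu #|S :\: T|)); first exact: addIr.
move=> T /andP[sTS nTS]; rewrite IHr.
  congr (_ * nu _); rewrite -[RHS]card_rev; apply: eq_card => x.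
  by rewrite -[x]rev_ordK mem_rev !inE !mem_rev.
by apply: leq_trans leSr; rewrite proper_card // properEneq nTS.
Qed.

End SubsetTransform.

(** * Counting sole preimages *)

Section SoleWords.

Variable n : nat.
Implicit Types (S T : {set 'I_n}) (v m : 'I_n) (w L R : seq nat).

Definition letters S : seq nat := [seq i.+1 | i : 'I_n in S].

(** The number [u(S,v)], with [v] counted from 0. The default of [head] differs from [v.+1], so the
    empty word is not counted. *)
Definition sole_words S v : nat :=
  count (fun w => sole_preimage w && (head 0 (stack_sort w) == v.+1))
    (permutations (letters S)).

Lemma letters_uniq S : uniq (letters S).
Proof. by rewrite map_inj_uniq ?enum_uniq // => i j [] /val_inj. Qed.

Lemma lettersP S x : reflect (exists2 i : 'I_n, i \in S & x = i.+1) (x \in letters S).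
Proof. exact: imageP. Qed.

Lemma mem_letters S (i : 'I_n) : (i.+1 \in letters S) = (i \in S).
Proof.
by apply/lettersP/idP => [[j Sj [/val_inj ->]]|Si] //; exists i.
Qed.

Lemma letters_split S S1 m : m \in S -> S1 \subset S :\ m ->
  perm_eq (letters S1 ++ m.+1 :: letters (S :\ m :\: S1)) (letters S).
Proof.
move=> Sm sS1.
have E x : (x \in letters S1 ++ m.+1 :: letters (S :\ m :\: S1)) = (x \in letters S).
  rewrite mem_cat inE; apply/idP/idP.
    case/or3P => [/lettersP[i Si ->]|/eqP->|/lettersP[i]].
    - by rewrite mem_letters; have := subsetP sS1 _ Si; rewrite inE => /andP[].
    - by rewrite mem_letters.
    - by rewrite !inE => /and3P[_ _ Si] ->; rewrite mem_letters.
  case/lettersP => i Si ->; rewrite !mem_letters !inE Si eqSS (inj_eq val_inj).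
  by case: (i \in S1); case: (i == m).
apply: uniq_perm => //; last exact: letters_uniq.
rewrite cat_uniq /= !letters_uniq negb_or !mem_letters !inE eqxx andbF /= andbT.
apply/andP; split.
  by apply/negP => /(subsetP sS1); rewrite !inE eqxx.
by apply/hasPn => x /lettersP[i iS ->]; rewrite mem_letters; case/setDP: iS.
Qed.

Lemma perm_letters_split S m L R : m \in S ->
  perm_eq (L ++ m.+1 :: R) (letters S) <->
  exists S1 : {set 'I_n}, [/\ S1 \subset S :\ m, perm_eq L (letters S1)
    & perm_eq R (letters (S :\ m :\: S1))].
Proof.
move=> Sm; split=> [pw|[S1 [sS1 pL pR]]]; last first.
  apply: perm_trans (letters_split Sm sS1).
  by rewrite perm_cat // perm_cons.
have Uw : uniq (L ++ m.+1 :: R) by rewrite (perm_uniq pw) letters_uniq.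
pose S1 := [set i : 'I_n | i.+1 \in L].
have sS1 : S1 \subset S :\ m.
  apply/subsetP => i; rewrite !inE => Li; rewrite -mem_letters -(perm_mem pw).
  rewrite mem_cat Li andbT; apply/eqP => def_i.
  by move: Uw; rewrite cat_uniq /= -def_i Li andbF.
have pL : perm_eq L (letters S1).
  apply: uniq_perm; rewrite ?letters_uniq //.
    by move: Uw; rewrite cat_uniq => /and3P[].
  move=> x; apply/idP/lettersP => [Lx|[i]]; last by rewrite inE => ? ->.
  have /lettersP[i _ def_x] : x \in letters S by rewrite -(perm_mem pw) mem_cat Lx.
  by exists i; rewrite // inE -def_x.
exists S1; split=> //; rewrite -(perm_cons m.+1) -(perm_cat2l L).
apply: perm_trans pw _; rewrite perm_sym.
by apply: perm_trans (letters_split Sm sS1); rewrite perm_cat2r.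
Qed.

Lemma letters_max S m L R : (forall x, x \in S -> x <= m) ->
  perm_eq (L ++ m.+1 :: R) (letters S) ->
  uniq (L ++ m.+1 :: R) /\ all (gtn m.+1) (L ++ R).
Proof.
move=> max_m pw; have Uw : uniq (L ++ m.+1 :: R) by rewrite (perm_uniq pw) letters_uniq.
split=> //; apply/allP => x LRx.
have /lettersP[i Si def_x] : x \in letters S.
  by rewrite -(perm_mem pw) mem_cat inE orbCA -mem_cat LRx orbT.
rewrite /= ltn_neqAle {2}def_x ltnS max_m // andbT; apply/eqP => x_m.
by move: Uw; rewrite uniq_catC /= mem_cat orbC -mem_cat -x_m LRx.
Qed.

Lemma sole_words_notin S v : v \notin S -> sole_words S v = 0.
Proof.
move=> nSv; apply/eqP; rewrite -leqn0 leqNgt -has_count; apply/hasPn => w.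
rewrite mem_permutations => pw; apply: contra nSv => /andP[_ /eqP hw].
rewrite -mem_letters -(perm_mem pw) -mem_stack_sort.
by case: (stack_sort w) hw => //= x s ->; rewrite mem_head.
Qed.

(** Unless [L] and [R] are both empty, the image of [L m R] starts with a letter below [m]. *)
Lemma sole_words_max S m : m \in S -> (forall x, x \in S -> x <= m) ->
  sole_words S m = (S == [set m]).
Proof.
move=> Sm max_m; case: eqVneq => [->|nS].
  have sole1 : sole_preimage [:: m.+1].
    by rewrite (@sole_preimage_max [::] [::]).
  have E1 : letters [set m] = [:: m.+1] by rewrite /letters /image_mem enum_set1.
  by rewrite /sole_words E1 /= sole1 eqxx.
apply/eqP; rewrite -leqn0 leqNgt -has_count; apply/hasPn => w.
rewrite mem_permutations => pw; apply: contra nS => /andP[_].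
have mw : m.+1 \in w by rewrite (perm_mem pw) mem_letters.
case/splitPr: w / mw pw => L R pw; have [Uw ltm] := letters_max max_m pw.
rewrite stack_sort_max //.
case: (eqVneq L [::]) => [L0|nL] hm; last first.
  have hL := head_stack_sort nL.
  have hlt : head 0 (stack_sort L) < m.+1.
    by apply: (allP ltm); rewrite mem_cat hL.
  move: nL hm hlt; rewrite -stack_sort_eq0.
  by case: (stack_sort L) => //= x s _ /eqP->; rewrite ltnn.
rewrite L0 /= in pw ltm hm; case: (eqVneq R [::]) => [R0|nR]; last first.
  have hlt : head 0 (stack_sort R) < m.+1 by apply: (allP ltm); rewrite head_stack_sort.
  move: nR hm hlt; rewrite -stack_sort_eq0.
  by case: (stack_sort R) => //= x s _ /eqP->; rewrite ltnn.
apply/eqP/setP => i; rewrite -mem_letters -(perm_mem pw) R0 !inE eqSS.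
by rewrite (inj_eq val_inj).
Qed.

(** The condition [w != [::]] guards against [P 0] holding at the default of [head]. *)
Lemma sum_sole_words S (P : pred nat) :
  \sum_(v : 'I_n | P v.+1) sole_words S v
  = count (fun w => [&& w != [::], sole_preimage w & P (head 0 (stack_sort w))])
      (permutations (letters S)).
Proof.
rewrite /sole_words -sum1_count [RHS]big_mkcond /=.
under eq_bigr => v _ do rewrite -sum1_count big_mkcond /=.
rewrite exchange_big /=; apply: eq_big_seq => w; rewrite mem_permutations => pw.
case: (eqVneq w [::]) => [-> /=|nw]; first by rewrite big1 // => v _; rewrite andbF.
case: (sole_preimage w) => /=; last by rewrite big1.
have /lettersP[v0 _ def_v] : head 0 (stack_sort w) \in letters S.
  by rewrite -(perm_mem pw) head_stack_sort.
rewrite -big_mkcondr /= def_v.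
rewrite (eq_bigl (fun v => (P v0.+1) && (v == v0))) => [|v]; last first.
  by rewrite eqSS (inj_eq val_inj) eq_sym; case: eqVneq => [->|]; rewrite ?andbF.
by case: (P _) => /=; rewrite ?big_pred1_eq ?big_pred0.
Qed.

(** By [sole_preimage_max], [join] is a bijection from triples [(S1, (L, R))] to the counted words;
    [v != m] rules out the one-letter word, so the image starts as [s(L)] does. *)
Lemma sole_words_rec S m v :
  m \in S -> (forall x, x \in S -> x <= m) -> v != m ->
  sole_words S v = \sum_(S1 : {set 'I_n} | S1 \subset S :\ m)
    \sum_(w : 'I_n | [exists x in S1, w < x])
    sole_words S1 v * sole_words (S :\ m :\: S1) w.
Proof.
move=> Sm max_m nvm.
pose okL L := sole_preimage L && (head 0 (stack_sort L) == v.+1).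
pose okR (S1 : {set 'I_n}) R := [&& R != [::], sole_preimage R
  & has (ltn (head 0 (stack_sort R))) (letters S1)].
pose Ls S1 := [seq L <- permutations (letters S1) | okL L].
pose Rs S1 := [seq R <- permutations (letters (S :\ m :\: S1)) | okR S1 R].
pose sets := enum (powerset (S :\ m)).
pose trip := [seq (S1, p) | S1 <- sets, p <- [seq (L, R) | L <- Ls S1, R <- Rs S1]].
pose join (t : {set 'I_n} * (seq nat * seq nat)) := t.2.1 ++ m.+1 :: t.2.2.
have szRs S1 : size (Rs S1)
    = \sum_(w : 'I_n | [exists x in S1, w < x]) sole_words (S :\ m :\: S1) w.
  rewrite size_filter -(sum_sole_words _ (fun h => has (ltn h) (letters S1))).
  apply: eq_bigl => w; apply/hasP/exists_inP => [[x /lettersP[i Si ->]]|[i Si lti]].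
    by exists i.
  by exists i.+1; rewrite ?mem_letters.
transitivity (size trip); last first.
  rewrite size_allpairs_dep sumnE big_map big_enum /=.
  apply: eq_big => [S1|S1 _]; first by rewrite powersetE.
  by rewrite size_allpairs szRs size_filter big_distrr.
rewrite -(size_map join) /sole_words -size_filter; apply: perm_size.
have memD t : t \in trip ->
    [/\ t.1 \subset S :\ m, t.2.1 \in Ls t.1 & t.2.2 \in Rs t.1].
  case/allpairsPdep => S1 [p []]; rewrite mem_enum powersetE => sS1.
  by case/allpairsP=> [[L R] [LL RR ->]] ->.
(* [S1] is determined by [L], which makes [join] injective on the triples. *)
have memL t : t \in trip -> t.1 = [set i : 'I_n | i.+1 \in t.2.1].
  case/memD => _; rewrite mem_filter mem_permutations => /andP[_ pL] _.
  by apply/setP => i; rewrite inE (perm_mem pL) mem_letters.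
have mL t : t \in trip -> m.+1 \notin t.2.1.
  move=> tt; apply/negP => mL; have [/subsetP/(_ m) sub _ _] := memD t tt.
  by move: sub; rewrite {1}(memL t tt) !inE eqxx => /(_ mL).
apply: uniq_perm.
- by rewrite filter_uniq ?permutations_uniq.
- rewrite map_inj_in_uniq => [|[S1 [L R]] [S2 [L' R']] tt tt' E].
    apply: allpairs_uniq_dep => [|S1 _|[S1 p1] [S2 p2] _ _ /= [-> ->] //].
      exact: enum_uniq.
    apply: allpairs_uniq => [||[? ?] [? ?] _ _ /= [-> ->] //];
      by rewrite filter_uniq ?permutations_uniq.
  have [/= EL ER] := cat_cons_inj (mL _ tt') (mL _ tt) E.
  by move: (memL _ tt) (memL _ tt') => /= -> ->; rewrite EL ER.
move=> w; rewrite mem_filter mem_permutations; apply/andP/mapP.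
  case=> [/andP[solew hw] pw].
  have mw : m.+1 \in w by rewrite (perm_mem pw) mem_letters.
  case/splitPr: w / mw pw solew hw => L R pw.
  have [Uw ltm] := letters_max max_m pw; rewrite sole_preimage_max //.
  rewrite stack_sort_max //; case/orP => [/andP[/eqP-> /eqP->]|].
    by rewrite /= eqSS eq_sym (inj_eq val_inj) (negPf nvm).
  case/and5P=> nL nR soleL soleR junction hw.
  have [S1 [sS1 pL pR]] := (perm_letters_split L R Sm).1 pw.
  exists (S1, (L, R)) => //; apply/allpairsPdep; exists S1, (L, R).
  rewrite mem_enum powersetE sS1; split=> //; apply/allpairsP; exists (L, R).
  rewrite !mem_filter !mem_permutations pL pR /okL /okR nR soleL soleR.
  rewrite -(perm_has _ pL) junction !andbT; split=> //.
  by move: nL hw; rewrite -stack_sort_eq0; case: (stack_sort L).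
case=> [[S1 [L R]] tt ->]; have [/= sS1] := memD _ tt.
rewrite !mem_filter !mem_permutations /join /= => /andP[okL1 pL] /andP[okR1 pR].
have pw : perm_eq (L ++ m.+1 :: R) (letters S).
  by apply/perm_letters_split => //; exists S1.
have [Uw ltm] := letters_max max_m pw.
move: okL1 okR1 => /andP[soleL hL] /and3P[nR soleR junction].
have nL : L != [::] by apply: contraTneq hL => ->.
split=> //; rewrite sole_preimage_max // nL nR soleL soleR (perm_has _ pL) junction.
rewrite orbT stack_sort_max //=.
by move: nL hL; rewrite -stack_sort_eq0; case: (stack_sort L).
Qed.

End SoleWords.

(** The counts are cast to [int] because [nu] takes negative values. *)
Lemma sole_words_rev (n : nat) (S : {set 'I_n}) (v : 'I_n) :
  sole_words [set rev_ord x | x in S] (rev_ord v) = sole_words S v.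
Proof.
have [nu [nu0 nuS]] := signed_catalan_exists.
pose u (S : {set 'I_n}) v : int := (sole_words S v)%:R%R.
suff : u [set rev_ord x | x in S] (rev_ord v) = u S v.
  by move/eqP; rewrite Num.Theory.eqr_nat => /eqP.
apply: (u_rev nu0 nuS); rewrite /u => {S v}.
- by move=> S v nSv; rewrite sole_words_notin.
- by move=> S m Sm max_m; rewrite sole_words_max //; case: eqP.
move=> S m v Sm max_m nvm; rewrite (sole_words_rec Sm max_m nvm).
rewrite GRing.natr_sum; apply: eq_bigr => S1 _.
by rewrite GRing.natr_sum; apply: eq_bigr => w _; rewrite GRing.natrM.
Qed.

(** * Permutations and their words *)

Lemma perm_words (n : nat) :
  perm_eq [seq word p | p <- enum 'S_n] (permutations (letters [set: 'I_n])).
Proof.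
have word_letters (p : 'S_n) : word p \in permutations (letters [set: 'I_n]).
  rewrite mem_permutations; apply: uniq_perm; rewrite ?letters_uniq //.
    by rewrite map_inj_uniq ?enum_uniq // => i j [] /ord_inj/perm_inj.
  move=> x; rewrite /word; apply/idP/lettersP => [/mapP[i _ ->]|[i _ ->]].
    by exists (p i); rewrite ?in_setT.
  by apply/mapP; exists (p^-1 i)%g; rewrite ?mem_enum ?permKV.
have word_inj : injective (@word n).
  move=> p q /eq_in_map E; apply/permP => i; apply/val_inj.
  by have [] := E i (mem_enum _ i).
have Uwords : uniq [seq word p | p <- enum 'S_n].
  by rewrite map_inj_uniq ?enum_uniq.
apply: uniq_perm => //; first exact: permutations_uniq.
(* Both lists have [n!] members, so one inclusion suffices. *)
apply: (uniq_min_size Uwords _ _).2.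
  by move=> w /mapP[p _ ->].
rewrite size_map -cardE card_Sn size_permutations ?letters_uniq //.
by rewrite size_map -cardE cardsT card_ord.
Qed.

Lemma card_words (n : nat) (P : pred (seq nat)) :
  #|[pred p : 'S_n | P (word p)]| = count P (permutations (letters [set: 'I_n])).
Proof.
rewrite -(seq.permP (perm_words n)) count_map -size_filter cardE.
by rewrite enumT /enum_mem; congr size; apply: eq_filter.
Qed.

(** [stack_sort] maps the sole preimages bijectively onto the words whose fibre has one element. *)
Lemma A_sole_words (m : nat) (v : 'I_(m.*2.-1)) :
  A m v.+1 = sole_words [set: 'I_(m.*2.-1)] v.
Proof.
rewrite /A /sole_words; move: (m.*2.-1) v => n v.
set W := permutations _; have UW : uniq W := permutations_uniq _.
pose fibre w := count (fun q => stack_sort q == w) W.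
transitivity (count (fun w => (fibre w == 1) && (head 0 w == v.+1)) W).
  rewrite -card_words cardsE; apply: eq_card => p.
  by rewrite unfold_in inE /uniquely_sorted /stack_preim cardsE /fibre -card_words.
have sortW q : q \in W -> stack_sort q \in W.
  by rewrite !mem_permutations; apply: perm_trans (perm_stack_sort q).
rewrite -!size_filter -[RHS](size_map stack_sort); apply: perm_size.
apply: uniq_perm; first by rewrite filter_uniq.
  rewrite map_inj_in_uniq ?filter_uniq // => q q'; rewrite !mem_filter.
  by move=> _ /andP[/andP[/sole_preimageP sole_q' _] _] /sole_q'.
move=> w; rewrite mem_filter; apply/idP/mapP => [/andP[/andP[/eqP fw hw] Ww]|[q]].
  have /hasP[q Wq /eqP def_w] : has (fun q => stack_sort q == w) W.
    by rewrite has_count -/(fibre w) fw.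
  exists q => //; rewrite mem_filter def_w hw Wq !andbT.
  apply/sole_preimageP => q' E; apply/eqP; case: eqVneq => // nq.
  have Wq' : q' \in W.
    by move: Wq; rewrite !mem_permutations; apply/perm_trans/stack_sort_perm_inj.
  have : uniq [:: q; q'] by rewrite /= inE eq_sym nq.
  move/uniq_leq_size => /(_ [seq q <- W | stack_sort q == w]).
  rewrite size_filter -/(fibre w) fw; apply=> x; rewrite !inE mem_filter.
  by case/orP => /eqP->; rewrite ?E def_w eqxx.
rewrite mem_filter => /andP[/andP[/sole_preimageP sole_q hq] Wq] ->.
rewrite hq sortW // !andbT; apply/eqP; transitivity (count_mem q W).
  by apply: eq_count => q' /=; apply/eqP/eqP => [/sole_q|->].
by rewrite count_uniq_mem ?Wq.
Qed.

Theorem theorem5p7 (k l : nat) (hl : 1 <= l <= 2 * k + 1) :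
  A k.+1 l = A k.+1 (2 * k + 2 - l).
Proof.
have [v ->] : exists v : 'I_(k.+1.*2.-1), l = v.+1.
  case: l hl => // l /andP[_ lel].
  have ltl : l < k.+1.*2.-1 by rewrite doubleS /=; lia.
  by exists (Ordinal ltl).
(* As [v] is counted from 0 up to [2k], [rev_ord v] is [2k - v]. *)
have -> : 2 * k + 2 - v.+1 = (rev_ord v).+1.
  by have := ltn_ord v; rewrite /=; lia.
rewrite !A_sole_words -sole_words_rev; congr (sole_words _ _).
by apply/setP => i; rewrite -[i]rev_ordK mem_imset ?inE //; apply: rev_ord_inj.
Qed.
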